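(* Let $n\ge 2$ and $s\ge 1$ be integers. (a) If $s$ is divisible by $n$, then $f_{\mathrm{trans}}(n,s)=s(n-1)$. (b) If $s$ is not divisible by $2$, then $f_{\mathrm{trans}}(2,s)=s-1$.
   Context: Let $N=\{1,\dots,n\}$ be a set of $n\ge 2$ agents and $M$ a finite set of indivisible goods. Each agent $i$ has an additive utility function $u_i:2^M\to\mathbb{R}_{\ge 0}$, i.e., $u_i(M')=\sum_{g\in M'}u_i(\{g\})$. An instance consists of $N$, $M$ and $(u_i)_{i\in N}$. An allocation $\mathcal{A}=(A_1,\dots,A_n)$ is an ordered partition of $M$ into $n$ (possibly empty) bundles, $A_i$ going to agent $i$; it is $s$-balanced if $|A_i|=s$ for all $i\in N$. Agent $i$ is EF1 towards agent $j$ in $\mathcal{A}$ if $A_j=\varnothing$ or there exists $g\in A_j$ with $u_i(A_i)\ge u_i(A_j\setminus\{g\})$. $\mathcal{A}$ is EF1 if every agent is EF1 towards every other agent. A transfer moves a single good from one agent's bundle to another agent's bundle, leaving everything else unchanged (so bundle sizes may change; the final allocation need not be $s$-balanced). $f_{\mathrm{trans}}(n,s)$ denotes the smallest integer such that for every instance with $n$ agents and $ns$ goods and every $s$-balanced allocation $\mathcal{A}$ in the instance, some EF1 allocation can be reached from $\mathcal{A}$ using at most $f_{\mathrm{trans}}(n,s)$ transfers. *)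

(* Defs.v *)
From HB Require Import structures.
From mathcomp Require Import all_boot all_order all_algebra.
From mathcomp Require Import reals.

Set Implicit Arguments.
Unset Strict Implicit.
Unset Printing Implicit Defensive.

Import Order.TTheory GRing.Theory Num.Theory.
Local Open Scope ring_scope.

(* The agents are the elements of 'I_n, numbered from 0. *)
Record instance (R : realType) (n : nat) := Instance {
  good : finType;
  util : 'I_n -> {set good} -> R;
  util_ge0 : forall i X, 0 <= util i X;
  util_additive : forall i X, util i X = \sum_(g in X) util i [set g]
}.

Section Allocations.

Variables (R : realType) (n : nat) (I : instance R n).

Definition bundles := {ffun 'I_n -> {set good I}}.

Implicit Types A B : bundles.

Definition is_allocation A :=
  [forall i, forall j, (i != j) ==> [disjoint A i & A j]]
  && (\bigcup_i A i == [set: good I]).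

Definition balanced (s : nat) A := [forall i, #|A i| == s].

Definition EF1_towards A (i j : 'I_n) :=
  (A j == set0) || [exists g in A j, util i (A j :\ g) <= util i (A i)].

Definition EF1 A := [forall i, forall j, (i != j) ==> EF1_towards A i j].

Definition move A (i j : 'I_n) (g : good I) : bundles :=
  [ffun k => if k == i then A i :\ g else if k == j then g |: A j else A k].

Definition transfer : rel bundles := fun A B =>
  [exists i, exists j, exists g,
    [&& i != j, g \in A i & B == move A i j g]].

Definition reachable_within (k : nat) A B :=
  exists p : seq bundles,
    [/\ path transfer A p, last A p = B & (size p <= k)%N].

End Allocations.

Definition transfers_suffice (R : realType) (n s k : nat) :=
  forall I : instance R n, #|good I| = (n * s)%N ->
  forall A : bundles I, is_allocation A -> balanced s A ->
  exists B : bundles I,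
    [/\ is_allocation B, EF1 B & reachable_within k A B].

(* f_trans_is R n s k states f_trans(n, s) = k. Minimising over nat is the same
   as over the integers: no path has negative length, and an instance with n * s
   goods and an s-balanced allocation always exists. *)
Definition f_trans_is (R : realType) (n s k : nat) :=
  transfers_suffice R n s k
  /\ forall k' : nat, transfers_suffice R n s k' -> (k <= k')%N.

(* Main.v *)
Require Import Defs.
From mathcomp Require Import all_boot all_order all_algebra all_fingroup.
From mathcomp Require Import reals.
From mathcomp Require Import zify.

Set Implicit Arguments.
Unset Strict Implicit.
Unset Printing Implicit Defensive.

Import Order.TTheory GRing.Theory Num.Theory.
Local Open Scope ring_scope.

(* Upper bounds. Split every original bundle A_k among all agents by round robin,
   one bundle after the other. A round robin causes no envy towards later pickers
   and envy of at most one good towards earlier ones, so EF1 survives if each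
   agent picks before those whom it already envies. Such an order exists after
   permuting the current shares so as to maximise total utility, subject to nobody
   losing: an envy cycle could otherwise be rotated. If s = n t, everybody keeps
   exactly t of its own goods. For n = 2 and s odd, let each agent pick first in
   its own bundle: it keeps (s + 1) / 2 goods and is envied only there.

   Lower bounds. If agents value their own goods at 0 and all others at 1, EF1
   forces each agent to receive at least (n - 1)(s - 1) / n foreign goods. *)

(** * Envy cycles and acyclic orders *)

(** [W i k] is the value of share [k] to agent [i]. An unenvied member in every nonempty [S] amounts
    to envy under [s] being acyclic. *)
Lemma envy_free_source (R : realDomainType) (N : finType) (W : N -> N -> R) :
  exists s : {perm N}, (forall i, W i i <= W i (s i)) /\
    forall S : {set N}, S != set0 ->
      exists2 x, x \in S & forall y, y \in S -> W y (s x) <= W y (s y).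
Proof.
pose P (s : {perm N}) := [forall i, W i i <= W i (s i)].
have P1 : P 1%g by apply/forallP => i; rewrite perm1.
pose F (s : {perm N}) := \sum_i W i (s i).
case: (arg_maxP F P1) => s /forallP Ps maxs; exists s; split=> // S S0.
suff /exists_inP[x xS /forall_inP] :
    [exists x in S, [forall y in S, W y (s x) <= W y (s y)]] by exists x.
apply: contraT => noS.
pose f x := odflt x [pick y in S | W y (s y) < W y (s x)].
have fP x : x \in S -> (f x \in S) && (W (f x) (s (f x)) < W (f x) (s x)).
  move=> xS; rewrite /f; case: pickP => [y //|noy].
  case/negP: noS; apply/exists_inP; exists x => //; apply/forall_inP => y yS.
  by have := noy y; rewrite yS /= leNgt => ->.
(* A smallest nonempty [f]-stable subset of [S] replaces an explicit envy cycle: its image under [f]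
   is again stable, so [f] permutes it. *)
pose Q (C : {set N}) := [&& C \subset S, C != set0 & f @: C \subset C].
have QS : Q S.
  rewrite /Q subxx S0; apply/subsetP => _ /imsetP[x xS ->].
  by case/andP: (fP x xS).
case: (arg_minnP (fun C : {set N} => #|C|) QS) => C /and3P[CS C0 fC] minC.
have fCC : f @: C = C.
  apply/eqP; rewrite eqEcard fC; apply: minC.
  rewrite /Q (subset_trans fC CS) imsetS // andbT.
  by case/set0Pn: C0 => x xC; apply/set0Pn; exists (f x); apply: imset_f.
have injf : {in C &, injective f} by apply/imset_injP; rewrite fCC.
pose h x := if x \in C then f x else x.
have fmem x : x \in C -> f x \in C by move=> xC; rewrite -fCC imset_f.
have injh : injective h.
  move=> x y; rewrite /h; case: ifPn => xC; case: ifPn => yC //.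
  - exact: injf.
  - by move=> e; move: yC; rewrite -e fmem.
  - by move=> e; move: xC; rewrite e fmem.
(* The rotation hands the share [s x] to [tau x], who envies it when [x] is in [C]; off [C] nothing
   changes. *)
pose tau := perm injh.
have gain x : W (tau x) (s (tau x)) <= W (tau x) (s x).
  rewrite permE /h; case: ifPn => // xC.
  by case/andP: (fP x (subsetP CS x xC)) => _ /ltW.
have Pnew : P (tau^-1 * s)%g.
  apply/forallP => i; apply: le_trans (Ps i) _.
  by have := gain (tau^-1 i)%g; rewrite permKV permM.
have /= := maxs _ Pnew; rewrite leNgt => /negP[].
have [x xC] := set0Pn _ C0.
have -> : F (tau^-1 * s)%g = \sum_x W (tau x) (s x).
  rewrite /F (reindex_inj (@perm_inj _ tau)); apply: eq_bigr => y _.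
  by rewrite permM permK.
rewrite /F (reindex_inj (@perm_inj _ tau)) (bigD1 x) // [ltRHS](bigD1 x) //=.
apply: ltr_leD; last exact: ler_sum.
by rewrite permE /h xC; case/andP: (fP x (subsetP CS x xC)).
Qed.

(** A source of the whole set goes first; the hypothesis on subsets supplies a source of whatever
    remains. *)
Lemma topological_order (N : finType) (r : rel N) :
  (forall S : {set N}, S != set0 ->
    exists2 x, x \in S & forall y, y \in S -> ~~ r y x) ->
  exists L : seq N, [/\ uniq L, forall x, x \in L &
    forall x y, r x y -> (index x L < index y L)%N].
Proof.
move=> src.
suff /(_ [set: N]) [L [uL memL ordL]] : forall S : {set N}, exists L : seq N,
    [/\ uniq L, L =i S &
      forall x y, x \in S -> y \in S -> r x y -> (index x L < index y L)%N].
  by exists L; split=> // [x|x y]; [rewrite memL inE | apply: ordL; rewrite inE].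
move=> S; move: {2}#|S|.+1 (ltnSn #|S|) => k; elim: k S => // k IH S ltk.
have [->|S0] := eqVneq S set0.
  by exists [::]; split=> // [x|x y]; rewrite inE.
have [x xS srcx] := src S S0.
have [|L [uL memL ordL]] := IH (S :\ x); first by rewrite (cardsD1 x) xS in ltk.
exists (x :: L); split=> [|y|y z yS zS ryz].
- by rewrite /= uL memL setD11.
- by rewrite in_cons memL in_setD1; case: eqVneq => // ->.
- have zx : x != z by apply: contraTneq ryz => <-; apply: srcx.
  rewrite /= (negPf zx); case: eqVneq => // yx.
  by rewrite ltnS ordL // in_setD1 ?yS ?zS eq_sym ?yx ?zx.
Qed.

(** * Round robin and EF1 for additive values *)

Section PickingGoods.

Variables (R : realDomainType) (N T : finType) (v : N -> T -> R).
Hypothesis v_ge0 : forall i g, 0 <= v i g.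

Definition val i (X : {set T}) := \sum_(g in X) v i g.

Definition part (o : T -> N) (X : {set T}) i := [set g in X | o g == i].

(* Agent [i], holding [Y], is EF1 towards a holder of [Z]. The first disjunct
   covers an empty [Z]. *)
Definition ef1 i (Y Z : {set T}) :=
  (val i Z <= val i Y) || [exists g in Z, val i (Z :\ g) <= val i Y].

Lemma val_setU i (X Y : {set T}) :
  [disjoint X & Y] -> val i (X :|: Y) = val i X + val i Y.
Proof.
by move=> dXY; rewrite /val -bigU //; apply: eq_bigl => g; rewrite inE.
Qed.

Lemma val_setD1 i (X : {set T}) g : g \in X -> val i X = v i g + val i (X :\ g).
Proof. exact: big_setD1. Qed.

Lemma ef1_le i (Y Z : {set T}) m :
  0 <= m -> (forall g, g \in Z -> v i g <= m) -> ef1 i Y Z ->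
  val i Z <= m + val i Y.
Proof.
move=> m0 lem /orP[le|/exists_inP[g gZ le]]; first by rewrite ler_wpDl.
by rewrite (val_setD1 _ gZ) lerD // lem.
Qed.

Lemma ef1_mono i Y Y' Z : val i Y <= val i Y' -> ef1 i Y Z -> ef1 i Y' Z.
Proof.
move=> leY /orP[le|/exists_inP[g gZ le]]; apply/orP; [left|right].
  exact: le_trans le leY.
by apply/exists_inP; exists g => //; apply: le_trans le leY.
Qed.

(** The good dropped from [Z1] also serves for the union, since the second parts add no envy. Old
    shares and a new round robin are merged this way. *)
Lemma ef1_setU i (Y1 Z1 Y2 Z2 : {set T}) :
  [disjoint Y1 & Y2] -> [disjoint Z1 & Z2] ->
  ef1 i Y1 Z1 -> val i Z2 <= val i Y2 -> ef1 i (Y1 :|: Y2) (Z1 :|: Z2).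
Proof.
move=> dY dZ e1 le2; rewrite /ef1 !val_setU //.
case/orP: e1 => [le1|/exists_inP[g gZ le1]]; first by rewrite lerD.
apply/orP; right; apply/exists_inP; exists g; first by rewrite inE gZ.
have gZ2 : g \notin Z2 by rewrite (disjointFr dZ gZ).
rewrite setDUl [Z2 :\ g](setDidPl _) ?disjoints1 1?disjoint_sym ?disjoints1 //.
by rewrite val_setU ?lerD // (disjointWl (subsetDl _ _)).
Qed.

(** Each agent in turn takes a favourite among the goods left, so a strictly better good must have
    been taken earlier. [x0] is a default value for [p]. *)
Lemma picking_round (x0 : T) (L : seq N) (X : {set T}) :
  uniq L -> (size L <= #|X|)%N ->
  exists p : N -> T, [/\ {in L &, injective p}, forall i, i \in L -> p i \in X &
    forall i g, i \in L -> g \in X -> v i (p i) < v i g ->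
      exists2 j, (index j L < index i L)%N & p j = g].
Proof.
elim: L X => [|a L IH] X /=; first by exists (fun _ => x0); split.
case/andP=> aL uL szL.
have [y yX] : exists y, y \in X by apply/card_gt0P; apply: leq_trans szL.
case: (arg_maxP (v a) yX) => x xX0 maxx; have {xX0} xX : x \in X by [].
have [|p [injp pX pP]] := IH (X :\ x) uL.
  by rewrite (cardsD1 x) xX in szL.
pose q i := if i == a then x else p i.
have qa : q a = x by rewrite /q eqxx.
have qL i : i \in L -> q i = p i.
  by move=> iL; rewrite /q; case: eqVneq aL => // <-; rewrite iL.
have pXL i : i \in L -> (p i != x) && (p i \in X) by move/pX; rewrite in_setD1.
exists q; split=> [i j|i|i g].
- rewrite !in_cons => /predU1P[->|iL] /predU1P[->|jL] //; rewrite ?qa ?qL //.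
  + by move=> e; case/andP: (pXL j jL); rewrite -e eqxx.
  + by move=> e; case/andP: (pXL i iL); rewrite e eqxx.
  + exact: injp.
- by rewrite in_cons => /predU1P[->|iL]; rewrite ?qa ?qL //; case/andP: (pXL i iL).
- rewrite in_cons => /predU1P[->|iL] gX; rewrite ?qa ?qL //.
    by move=> lt; have /= := maxx g gX; rewrite leNgt lt.
  move=> lt; have ai : a == i = false by apply: contraNF aL => /eqP->.
  have [->|gx] := eqVneq g x; first by exists a; rewrite ?eqxx ?ai.
  have gXx : g \in X :\ x by rewrite in_setD1 gx.
  have [j ltj pj] := pP i g iL gXx lt.
  have jL : j \in L by rewrite -index_mem (ltn_trans ltj) // index_mem.
  have aj : a == j = false by apply: contraNF aL => /eqP->.
  by exists j; rewrite ?qL // ai aj.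
Qed.

(** Induction peels off the first round. For EF1, drop the first pick of [j]: by induction the rest
    exceeds the later picks of [i] by at most one good, and the first pick of [i] is worth at least
    any good left after that round. *)
Lemma round_robin (i0 : N) (L : seq N) (t : nat) (X : {set T}) :
  uniq L -> (forall i, i \in L) -> #|X| = (#|N| * t)%N ->
  exists o : T -> N, [/\ forall i, #|part o X i| = t,
    forall i j, (index i L < index j L)%N ->
      val i (part o X j) <= val i (part o X i) &
    forall i j, ef1 i (part o X i) (part o X j)].
Proof.
move=> uL allL; elim: t X => [|t IH] X cardX.
  have X0 : X = set0 by apply/eqP; rewrite -cards_eq0 cardX muln0.
  have p0 i : part (fun _ => i0) X i = set0.
    by apply/setP => g; rewrite X0 !inE.
  exists (fun _ => i0); split=> [i|i j _|i j]; rewrite /ef1 !p0 ?cards0 //.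
  by rewrite lexx.
have szL : size L = #|N|.
  by rewrite -(card_uniqP uL); apply: eq_card => i; rewrite allL.
have [x0 _] : exists x0, x0 \in X.
  by apply/card_gt0P; rewrite cardX muln_gt0 /= andbT; apply/card_gt0P; exists i0.
have [|p [injp pX pP]] := @picking_round x0 L X uL.
  by rewrite szL cardX mulnS leq_addr.
have {}injp : injective p by move=> i j; apply: injp.
have {}pX i : p i \in X by apply: pX.
pose P := p @: [set: N].
have PX : P \subset X by apply/subsetP => _ /imsetP[i _ ->].
have [|o [cardo ordo ef1o]] := IH (X :\: P).
  rewrite cardsD (setIidPr PX) card_imset // cardsT cardX.
  by rewrite mulnS addKn.
have best i g : g \in X :\: P -> v i g <= v i (p i).
  rewrite in_setD => /andP[gP gX]; rewrite leNgt; apply/negP => lt.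
  by have [j _ e] := pP i g (allL i) gX lt; rewrite -e imset_f // inE in gP.
pose o' g := odflt (o g) [pick i | p i == g].
have o'p i : o' (p i) = i.
  by rewrite /o'; case: pickP => [j /eqP/injp //|/(_ i)]; rewrite eqxx.
have o'n g : g \notin P -> o' g = o g.
  rewrite /o'; case: pickP => [j /eqP <-|//].
  by rewrite imset_f // inE.
have partE i : part o' X i = p i |: part o (X :\: P) i.
  apply/setP => g; rewrite !inE; have [/imsetP[j _ ->]|gP] := boolP (g \in P).
    by rewrite o'p pX (inj_eq injp) orbF.
  have gp : g != p i by apply: contraNneq gP => ->; rewrite imset_f ?inE.
  by rewrite o'n // (negPf gp).
have pnot i j : p i \notin part o (X :\: P) j by rewrite !inE imset_f // inE.
have valE i j : val i (part o' X j) = v i (p j) + val i (part o (X :\: P) j).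
  by rewrite partE /val big_setU1.
exists o'; split=> [i|i j ltij|i j].
- by rewrite partE cardsU1 pnot cardo.
- rewrite !valE lerD ?ordo // leNgt; apply/negP => lt.
  have [k ltk /injp e] := pP i (p j) (allL i) (pX j) lt.
  by rewrite e ltnNge ltnW in ltk.
- apply/orP; right; apply/exists_inP; exists (p j).
    by rewrite partE setU11.
  rewrite valE partE setU1K //; apply: ef1_le => // g.
  by rewrite inE => /andP[gX _]; apply: best.
Qed.

(** [c] gives the category of a good, later its original bundle, and [m] counts the categories
    already split. Permuting whole shares preserves the count [t] per agent and category, because it
    is the same for all shares. *)
Lemma fair_in_categories (i0 : N) (m t : nat) (c : T -> nat) :
  (forall k, (k < m)%N -> #|[set g | c g == k]| = (#|N| * t)%N) ->
  exists o : T -> N,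
    (forall k i, (k < m)%N -> #|part o [set g | c g == k] i| = t) /\
    forall i j, ef1 i (part o [set g | (c g < m)%N] i) (part o [set g | (c g < m)%N] j).
Proof.
elim: m => [|h IH] cardc.
  have p0 i : part (fun _ => i0) [set g | (c g < 0)%N] i = set0.
    by apply/setP => g; rewrite !inE.
  by exists (fun _ => i0); split=> // i j; rewrite /ef1 !p0 lexx.
have [k ltk|o [cardo ef1o]] := IH; first by apply: cardc; apply: ltnW.
pose S := [set g | (c g < h)%N]; pose X := [set g | c g == h].
have [s [incs srcs]] := envy_free_source (fun i k => val i (part o S k)).
(* [r i j] says that [i] envies [j] after the permutation, so [i] has to pick before [j]. *)
pose r i j := val i (part o S (s i)) < val i (part o S (s j)).
have [|L [uL allL ordL]] := @topological_order N r.
  move=> Q /srcs[x xQ xP]; exists x => // y yQ.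
  by rewrite /r -leNgt; apply: xP.
have [oX [cardX ordX ef1X]] := round_robin i0 uL allL (cardc h (leqnn _)).
(* Agent [i] now holds the old share [s i], hence the inverse of [s] on old owners. *)
pose o' g := if c g == h then oX g else (s^-1)%g (o g).
have sV x i : ((s^-1)%g x == i) = (x == s i).
  by rewrite -(inj_eq (@perm_inj _ s)) permKV.
have partE i : part o' [set g | (c g < h.+1)%N] i = part o S (s i) :|: part oX X i.
  apply/setP => g; rewrite !inE /o' ltnS leq_eqVlt.
  by case: ltngtP => //= _; rewrite ?sV ?orbF.
have disj i j : [disjoint part o S i & part oX X j].
  rewrite -setI_eq0; apply/eqP/setP => g; rewrite !inE.
  by case: ltngtP => //=; rewrite andbF.
exists o'; split=> [k i|i j].
  rewrite ltnS leq_eqVlt => /predU1P[->|ltk].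
    rewrite -(cardX i); apply: eq_card => g; rewrite !inE /o'.
    by case: (c g == h).
  rewrite -(cardo k (s i) ltk); apply: eq_card => g; rewrite !inE /o'.
  by case: (c g =P k) => //= ->; rewrite (ltn_eqF ltk) sV.
(* An envious [i] picks first and gains no new envy; its old share was EF1 towards every share and
   its present one is worth no less. Otherwise the old part is free of envy, and the round robin is
   the part that is only EF1. *)
rewrite !partE; case: (boolP (r i j)) => [rij|].
  apply: ef1_setU => //; last by rewrite ordX ?ordL.
  by apply: ef1_mono (ef1o i (s j)); apply: incs.
rewrite /r -leNgt => le; rewrite ![_ :|: part oX _ _]setUC.
by apply: ef1_setU => //; rewrite disjoint_sym.
Qed.

(* [a] takes a favourite good first, which leaves a round robin in which the
   other agent [b] starts. *)
Lemma odd_bundle_split (a b : N) (t : nat) (X : {set T}) :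
  a != b -> (forall i, i \in [:: b; a]) -> #|X| = (2 * t + 1)%N ->
  exists o : T -> N, [/\ #|part o X a| = t.+1,
    val a (part o X b) <= val a (part o X a) & ef1 b (part o X b) (part o X a)].
Proof.
move=> ab allL cardX.
have uL : uniq [:: b; a] by rewrite /= inE eq_sym ab.
have cardN : #|N| = 2.
  by rewrite -[2]/(size [:: b; a]) -(card_uniqP uL); apply: eq_card => i; rewrite allL.
have [y yX] : exists y, y \in X by apply/card_gt0P; rewrite cardX addn1.
case: (arg_maxP (v a) yX) => x xX0 maxx; have {xX0} xX : x \in X by [].
have [|o [cardo ordo ef1o]] := @round_robin a [:: b; a] t (X :\ x) uL allL.
  by have := cardsD1 x X; rewrite xX cardX cardN /=; lia.
pose o' g := if g == x then a else o g.
have partb : part o' X b = part o (X :\ x) b.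
  by apply/setP => g; rewrite !inE /o'; case: (eqVneq g x); rewrite ?(negPf ab) ?andbF.
have parta : part o' X a = x |: part o (X :\ x) a.
  apply/setP => g; rewrite !inE /o'; case: (eqVneq g x) => // ->.
  by rewrite xX eqxx.
have xn : x \notin part o (X :\ x) a by rewrite !inE eqxx.
exists o'; split; rewrite ?partb ?parta.
- by rewrite cardsU1 xn cardo.
(* In the remainder [a] envies by at most one good, and its favourite [x] makes up for any such
   good. *)
- rewrite {2}/val big_setU1 //; apply: ef1_le => // g.
  by rewrite !inE => /andP[/andP[_ gX] _]; apply: maxx.
(* Once [x] is dropped, [b] has picked first and sees no envy. *)
- apply/orP; right; apply/exists_inP; exists x; first exact: setU11.
  by rewrite setU1K // ordo //= eqxx [b == a]eq_sym (negPf ab).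
Qed.

End PickingGoods.

(** * Owner functions and the counting of transfers *)

Lemma card_fibers (K T : finType) (f : T -> K) (X : {set T}) :
  #|X| = (\sum_k #|[set g in X | f g == k]|)%N.
Proof.
rewrite -sum1_card (partition_big f xpredT) //; apply: eq_bigr => k _.
by rewrite -sum1_card; apply: eq_bigl => g; rewrite inE.
Qed.

Section OwnerFunctions.

Variables (R : realType) (n : nat) (I : instance R n).

(** With an owner function, disjointness and covering are automatic, and the goods to be moved are
    those whose owner changes. *)
Definition bundles_of (o : good I -> 'I_n) : bundles I :=
  [ffun i => [set g | o g == i]].

Lemma is_allocation_bundles_of o : is_allocation (bundles_of o).
Proof.
apply/andP; split.
  apply/forallP => i; apply/forallP => j; apply/implyP => ij.
  rewrite -setI_eq0; apply/eqP/setP => g; rewrite !ffunE !inE.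
  by case: (o g =P i) => //= ->; apply: negPf.
apply/eqP/setP => g; rewrite inE; apply/bigcupP.
by exists (o g) => //; rewrite ffunE inE.
Qed.

Lemma allocation_owner (A : bundles I) :
  is_allocation A -> exists o, A = bundles_of o.
Proof.
case/andP=> /forallP dA /eqP cA.
have ex g : [exists i, g \in A i].
  have : g \in \bigcup_i A i by rewrite cA inE.
  by case/bigcupP => i _ gi; apply/existsP; exists i.
exists (fun g => xchoose (existsP (ex g))); apply/ffunP => i; rewrite ffunE.
apply/setP => g; rewrite inE; have := xchooseP (existsP (ex g)).
set j := xchoose _ => gj; case: eqVneq gj => [-> //|ji gj].
by have /forallP/(_ i)/implyP/(_ ji) d := dA j; rewrite (disjointFr d gj).
Qed.

(** Each misplaced good is sent straight to its final owner, one transfer per good. *)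
Lemma reachable_bundles_of o o' :
  reachable_within #|[set g | o g != o' g]| (bundles_of o) (bundles_of o').
Proof.
move: {2}#|_| (erefl #|[set g | o g != o' g]|) => k; elim: k o => [|k IH] o card.
  exists [::]; split=> //=; apply/ffunP => i; rewrite !ffunE; apply/setP => g.
  by have /setP/(_ g) := cards0_eq card; rewrite !inE => /negbFE/eqP->.
have [g] : exists g, g \in [set g | o g != o' g] by apply/card_gt0P; rewrite card.
move=> gD; have := gD; rewrite inE => neq.
pose o1 x := if x == g then o' g else o x.
have D1 : [set x | o1 x != o' x] = [set x | o x != o' x] :\ g.
  apply/setP => x; rewrite !inE /o1; case: (eqVneq x g) => // ->.
  by rewrite eqxx.
have card1 : #|[set x | o1 x != o' x]| = k.
  by have := cardsD1 g [set x | o x != o' x]; rewrite D1 gD card; case.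
have [p [pp lastp szp]] := IH o1 card1.
exists (bundles_of o1 :: p); split=> //=; last by rewrite card -card1.
rewrite pp andbT; apply/existsP; exists (o g); apply/existsP; exists (o' g).
apply/existsP; exists g; rewrite neq ffunE inE eqxx /=.
apply/eqP/ffunP => i; rewrite !ffunE; apply/setP => x.
rewrite (fun_if (fun S : {set good I} => x \in S)) inE /o1.
case: (eqVneq i (o g)) => [->|io]; first rewrite !inE.
  by case: (eqVneq x g) => // _; rewrite eq_sym (negPf neq).
rewrite (fun_if (fun S : {set good I} => x \in S)).
case: (eqVneq i (o' g)) => [->|io']; rewrite !inE.
  by case: (eqVneq x g) => //; rewrite eqxx.
by case: (eqVneq x g) => // ->; rewrite eq_sym (negPf io') eq_sym (negPf io).
Qed.

Definition good_util (i : 'I_n) (g : good I) : R := util i [set g].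

Lemma good_util_ge0 i g : 0 <= good_util i g.
Proof. exact: util_ge0. Qed.

Lemma EF1_bundles_of o :
  (forall i j, ef1 good_util i (part o setT i) (part o setT j)) ->
  EF1 (bundles_of o).
Proof.
have pE i : part o setT i = bundles_of o i.
  by rewrite ffunE; apply/setP => g; rewrite !inE.
have uE i X : val good_util i X = util i X by rewrite util_additive.
move=> ef; apply/forallP => i; apply/forallP => j; apply/implyP => _.
rewrite /EF1_towards; have [//|] := eqVneq (bundles_of o j) set0.
move/set0Pn => [g gj] /=; have := ef i j; rewrite !pE => /orP[le|].
  apply/exists_inP; exists g => //; rewrite -!uE; apply: le_trans le.
  by rewrite (val_setD1 _ _ gj) lerDr good_util_ge0.
by case/exists_inP => h hj le; apply/exists_inP; exists h => //; rewrite -!uE.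
Qed.

(** One transfer brings one good to one agent, so the total number of newly held goods grows by at
    most one. *)
Lemma transferred_goods (A : bundles I) p :
  path (@transfer R n I) A p ->
  (\sum_i #|last A p i :\: A i| <= size p)%N.
Proof.
elim: p A => [|B p IH] A /=.
  by move=> _; rewrite big1 // => i _; rewrite setDv cards0.
case/andP=> /existsP[i /existsP[j /existsP[g /and3P[ij gi /eqP eB]]]] /IH le.
have step k : (#|B k :\: A k| <= (k == j))%N.
  rewrite eB ffunE; case: (eqVneq k i) => [->|_].
    by rewrite (_ : _ :\: _ = set0) ?cards0 //; apply/setP => x; rewrite !inE; case: (x \in A i); rewrite ?andbF.
  case: eqVneq => [->|_]; last by rewrite setDv cards0.
  apply: (@leq_trans #|[set g]|); last by rewrite cards1.
  apply: subset_leq_card; apply/subsetP => x.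
  by rewrite !inE; case: (x \in A j); rewrite ?orbF.
have sum1 : (\sum_k (k == j) = 1)%N.
  by rewrite (bigD1 j) //= eqxx big1 // => k /negPf->.
rewrite -addn1 -sum1; apply: leq_trans (leq_add le (leqnn _)).
rewrite -big_split; apply: leq_sum => k _ /=.
apply: leq_trans (leq_add (leqnn _) (step k)).
apply: leq_trans (leq_card_setU _ _); apply: subset_leq_card.
by apply/subsetP => x; rewrite !inE => /andP[-> ->]; case: (x \in B k).
Qed.

End OwnerFunctions.

(** * The instance where only foreign goods have value *)

Section WorstCase.

Variables (R : realType) (n s : nat).

(** The first component of a good is its initial owner. *)
Definition foreign_util (i : 'I_n) (X : {set 'I_n * 'I_s}) : R :=
  #|[set g in X | g.1 != i]|%:R.

Lemma foreign_util_ge0 i X : 0 <= foreign_util i X.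
Proof. exact: ler0n. Qed.

Lemma foreign_util_additive i X :
  foreign_util i X = \sum_(g in X) foreign_util i [set g].
Proof.
rewrite /foreign_util -natr_sum -sum1_card; congr _%:R.
under eq_bigl => g do rewrite inE.
rewrite big_mkcondr; apply: eq_bigr => g _; case: ifPn => gi.
  rewrite (_ : [set _ in _ | _] = [set g]) ?cards1 //; apply/setP => h.
  by rewrite !inE; case: eqVneq => // ->.
rewrite (_ : [set _ in _ | _] = set0) ?cards0 //; apply/setP => h.
by rewrite !inE; case: eqVneq => // ->; apply: negPf.
Qed.

Definition foreign_instance :=
  Instance foreign_util_ge0 foreign_util_additive.

(** [x i] counts the goods that [i] has received. By EF1 every other bundle has at most [x i + 1]
    goods foreign to [i]; summing over all bundles counts the [n * s - s] goods foreign to [i]. *)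
Lemma transfers_suffice_lower k : transfers_suffice R n s k ->
  exists x : 'I_n -> nat,
    (forall i, (n * s - s <= n * x i + (n - 1))%N) /\ (\sum_i x i <= k)%N.
Proof.
have cardG : #|good foreign_instance| = (n * s)%N by rewrite card_prod !card_ord.
pose own (g : good foreign_instance) := g.1.
have cardO i : #|[set g | own g == i]| = s.
  rewrite -[RHS]card_ord -(card_imset predT (_ : injective (fun j : 'I_s => (i, j)))).
    apply: eq_card => -[j l]; rewrite !inE; apply/eqP/imsetP => [<-|[h _ [-> _]] //].
    by exists l.
  by move=> j l [].
move=> suff; have [||B [/allocation_owner[o ->] /forallP ef [p [pp lastp szp]]]] :=
  suff foreign_instance cardG (bundles_of own).
- exact: is_allocation_bundles_of.
- by apply/forallP => i; rewrite ffunE cardO.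
pose A := bundles_of own.
exists (fun i => #|bundles_of o i :\: A i|); split; last first.
  rewrite -lastp; apply: leq_trans szp; exact: transferred_goods.
(* For the fixed [i], [x j] counts the goods foreign to [i] held by [j]; at [j = i] it is the
   witness above. *)
move=> i; pose x j := #|[set g in bundles_of o j | g.1 != i]|.
have xi : x i = #|bundles_of o i :\: A i|.
  by apply: eq_card => g; rewrite !ffunE !inE andbC.
have xj j : j != i -> (x j <= x i + 1)%N.
  move=> ji; have /forallP/(_ j)/implyP := ef i; rewrite eq_sym ji => /(_ isT).
  case/orP => [/eqP e|/exists_inP[g gj]].
    by rewrite /x e (_ : [set _ in _ | _] = set0) ?cards0 //; apply/setP => g; rewrite !inE.
  rewrite ler_nat -/(x i) addn1 -ltnS => le; apply: leq_trans (le).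
  apply: (@leq_trans #|g |: [set h in bundles_of o j :\ g | h.1 != i]|).
    apply: subset_leq_card; apply/subsetP => h; rewrite !inE.
    by case: (eqVneq h g).
  by rewrite cardsU1 !inE eqxx.
have sumx : (\sum_j x j = n * s - s)%N.
  have := cardsC [set g | own g == i]; rewrite cardO cardG => <-; rewrite addKn.
  rewrite (card_fibers o); apply: eq_bigr => j _; apply: eq_card => g.
  by rewrite !ffunE !inE andbC.
rewrite -sumx -xi (bigD1 i) //=.
have -> : (n * x i + (n - 1) = x i + \sum_(j | j != i) (x i + 1))%N.
  rewrite sum_nat_const; have -> : #|[pred j | j != i]| = (n - 1)%N.
    by have := cardC1 i; rewrite card_ord -subn1 => <-; apply: eq_card => j; rewrite !inE.
  by have := ltn_ord i; nia.
by rewrite leq_add2l; apply: leq_sum => j; apply: xj.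
Qed.

End WorstCase.

Theorem theoremC7 (R : realType) (n s : nat) (hn : (2 <= n)%N) (hs : (1 <= s)%N) :
  ((n %| s)%N -> f_trans_is R n s (s * (n - 1))%N) /\
  (~~ (2 %| s)%N -> f_trans_is R 2 s (s - 1)%N).
Proof.
split=> [/dvdnP[t st] | sodd]; split.
- move=> I cardI A /allocation_owner[a ->] /forallP balA.
  have carda k : (k < n)%N -> #|[set g | (a g : nat) == k]| = (#|'I_n| * t)%N.
    move=> kn; have := balA (Ordinal kn); rewrite ffunE st card_ord mulnC => /eqP <-.
    by apply: eq_card => g; rewrite !inE.
  have [o [cardo efo]] := fair_in_categories (@good_util_ge0 R n I) (Ordinal (ltnW hn)) carda.
  exists (bundles_of o); split; first exact: is_allocation_bundles_of.
    apply: EF1_bundles_of => i j; have := efo i j.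
    by rewrite (_ : [set g | (a g < n)%N] = setT) //; apply/setP => g; rewrite !inE ltn_ord.
  (* Each of the [n] agents keeps [t] of its own goods, so [s] goods stay and [n * s - s] move. *)
  have kept : #|[set g | a g == o g]| = s.
    rewrite (card_fibers a) (eq_bigr (fun=> t)) => [|k _].
      by rewrite sum_nat_const card_ord st mulnC.
    rewrite -(cardo k k (ltn_ord k)); apply: eq_card => g; rewrite !inE andbC.
    by rewrite -val_eqE; case: (a g =P k :> nat) => //= /val_inj->; rewrite eq_sym.
  have [p [pp lastp szp]] := reachable_bundles_of a o; exists p; split=> //.
  apply: leq_trans szp _; have := cardsC [set g | a g == o g].
  rewrite kept cardI (_ : ~: _ = [set g | a g != o g]); first by nia.
  by apply/setP => g; rewrite !inE.
- move=> k /transfers_suffice_lower[x [lex sumx]]; apply: leq_trans sumx.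
  (* Now [n * s - s] is [n] times [(n - 1) * t], and the slack [n - 1] is below [n], so rounding
     loses nothing. *)
  apply: (@leq_trans (\sum_(i < n) (n - 1) * t)%N).
    by rewrite sum_nat_const card_ord st; nia.
  apply: leq_sum => i _; have := lex i; rewrite st; nia.
- move=> I cardI A /allocation_owner[a ->] /forallP balA.
  pose i0 : 'I_2 := ord0; pose i1 : 'I_2 := ord_max.
  have all2 i : i = i0 \/ i = i1.
    by case: i => -[|[|//]] lt2; [left | right]; apply: val_inj.
  pose t := s./2; have st : s = (2 * t + 1)%N.
    by rewrite dvdn2 negbK in sodd; rewrite -[LHS]odd_double_half sodd -mul2n addnC.
  pose X k := [set g | a g == k].
  have cardX k : #|X k| = (2 * t + 1)%N.
    by have := balA k; rewrite ffunE -st => /eqP.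
  have ge0 := @good_util_ge0 R 2 I.
  have [||o0 [card0 noenvy0 efo0]] := odd_bundle_split ge0 (a := i0) (b := i1) _ _ (cardX i0).
  - by [].
  - by move=> i; case: (all2 i) => ->.
  have [||o1 [card1 noenvy1 efo1]] := odd_bundle_split ge0 (a := i1) (b := i0) _ _ (cardX i1).
  - by [].
  - by move=> i; case: (all2 i) => ->.
  pose o g := if a g == i0 then o0 g else o1 g.
  have partE i : part o setT i = part o0 (X i0) i :|: part o1 (X i1) i.
    apply/setP => g; rewrite !inE /o.
    by case: (all2 (a g)) => -> /=; rewrite ?orbF.
  have disj i j : [disjoint part o0 (X i0) i & part o1 (X i1) j].
    rewrite -setI_eq0; apply/eqP/setP => g; rewrite !inE.
    by case: (all2 (a g)) => -> /=; rewrite ?andbF.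
  exists (bundles_of o); split; first exact: is_allocation_bundles_of.
    apply: EF1_bundles_of => i j; rewrite !partE.
    (* Each agent is free of envy within its own original bundle and EF1 within the other; for [i0]
       the union is swapped so that the EF1 part comes first. *)
    case: (all2 i) => ->; case: (all2 j) => ->; try by rewrite /ef1 lexx.
      by rewrite ![_ :|: part o1 _ _]setUC; apply: ef1_setU; rewrite 1?disjoint_sym.
    exact: ef1_setU.
  (* Both agents keep [t + 1] goods, so [2 * s - (2 * t + 2) = s - 1] goods move. *)
  have kept : #|[set g | a g == o g]| = (2 * t + 2)%N.
    rewrite (card_fibers a) big_ord_recl big_ord1.
    rewrite (_ : lift _ _ = i1); last exact: val_inj.
    transitivity (t.+1 + t.+1)%N; last by lia.
    congr (_ + _)%N.
    - rewrite -card0; apply: eq_card => g; rewrite !inE /o.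
      by case: (all2 (a g)) => -> /=; rewrite ?andbF ?andbT // eq_sym.
    - rewrite -card1; apply: eq_card => g; rewrite !inE /o.
      by case: (all2 (a g)) => -> /=; rewrite ?andbF ?andbT // eq_sym.
  have [p [pp lastp szp]] := reachable_bundles_of a o; exists p; split=> //.
  apply: leq_trans szp _; have := cardsC [set g | a g == o g].
  rewrite kept cardI (_ : ~: _ = [set g | a g != o g]); first by lia.
  by apply/setP => g; rewrite !inE.
- move=> k /transfers_suffice_lower[x [lex sumx]]; apply: leq_trans sumx.
  (* The bound reads [s <= 2 * x i + 1]; for odd [s] each agent receives at least [(s - 1) / 2]
     goods. *)
  rewrite !big_ord_recl big_ord0; have := lex ord0; have := lex (lift ord0 ord0).
  move: sodd; rewrite dvdn2; lia.
Qed.
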